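(* Assume $A=[a_1\ \cdots\ a_n]\in\mathbb{R}^{m\times n}$ is a nonzero matrix and $0\in\operatorname{conv}(A)=\operatorname{conv}\{a_1,\dots,a_n\}$. Then $w(A)\ge\phi(A)>0$.
   Context: $\|\cdot\|$ is the Euclidean norm and $\langle\cdot,\cdot\rangle$ the standard inner product. $\Delta_{n-1}=\{x\in\mathbb{R}^n:x\ge0,\ \|x\|_1=1\}$. For $x\in\mathbb{R}^n$ with $x\ge0$ (componentwise), $S(x)=\{i:x_i>0\}$. Relative width: $$w(A)=\min_{x\ge 0,\ Ax\ne 0}\ \max_{\ell,j}\left\{\frac{\langle Ax,a_\ell-a_j\rangle}{\|Ax\|}:\ \ell\in S(x),\ j\in\{1,\dots,n\}\right\}.$$ Restricted width: for $x\ge0$ with $Ax\ne0$, $$\phi(A,x)=\sup\left\{\lambda>0:\ \exists\,u,v\in\Delta_{n-1},\ S(u)\subseteq S(x),\ Au-Av=\frac{\lambda}{\|Ax\|}Ax\right\},$$ and $\phi(A)=\min\{\phi(A,x):x\ge0,\ Ax\ne0\}$. *)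

(* Defs.v *)
From HB Require Import structures.
From mathcomp Require Import all_boot all_order all_algebra.
From mathcomp Require Import all_classical all_reals.

Set Implicit Arguments.
Unset Strict Implicit.
Unset Printing Implicit Defensive.

Import Order.TTheory GRing.Theory Num.Theory.
Local Open Scope classical_set_scope.
Local Open Scope ring_scope.

Definition dotv (R : realType) (n : nat) (x y : 'cV[R]_n) : R :=
  \sum_i x i 0 * y i 0.

(* The norm `|x| that MathComp-Analysis puts on matrices is the sup norm. *)
Definition enorm (R : realType) (n : nat) (x : 'cV[R]_n) : R :=
  Num.sqrt (dotv x x).

Definition norm1 (R : realType) (n : nat) (x : 'cV[R]_n) : R :=
  \sum_i `|x i 0|.

Definition nonneg (R : realType) (n : nat) (x : 'cV[R]_n) : Prop :=
  forall i, 0 <= x i 0.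

Definition simplex (R : realType) (n : nat) : set 'cV[R]_n :=
  [set x | nonneg x /\ norm1 x = 1].

Definition supp (R : realType) (n : nat) (x : 'cV[R]_n) : {set 'I_n} :=
  [set i | 0 < x i 0]%SET.

(* A *m u is the combination of the columns of A with weights u. *)
Definition conv_cols (R : realType) (m n : nat) (A : 'M[R]_(m, n)) :
    set 'cV[R]_m :=
  [set A *m u | u in @simplex R n].

Definition is_min (R : realType) (E : set R) (r : R) : Prop :=
  E r /\ lbound E r.

Definition admissible (R : realType) (m n : nat) (A : 'M[R]_(m, n)) :
    set 'cV[R]_n :=
  [set x | nonneg x /\ A *m x != 0].

(* For admissible x the support is nonempty and the pairs with j = l give the
   value 0, so the default value 0 does not affect the maximum. *)
Definition width_at (R : realType) (m n : nat) (A : 'M[R]_(m, n))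
    (x : 'cV[R]_n) : R :=
  \big[Num.max/0]_(l in supp x) \big[Num.max/0]_(j < n)
    (dotv (A *m x) (col l A - col j A) / enorm (A *m x)).

(* Classically a minimum; the infimum is total and is the minimum whenever
   [is_min _ (relative_width A)] holds. Likewise for restricted_width. *)
Definition relative_width (R : realType) (m n : nat) (A : 'M[R]_(m, n)) : R :=
  inf [set width_at A x | x in admissible A].

(* sup is 0 on an empty or unbounded set; when 0 is in conv_cols A and x is
   admissible, the set below is nonempty and bounded. *)
Definition restricted_width_at (R : realType) (m n : nat) (A : 'M[R]_(m, n))
    (x : 'cV[R]_n) : R :=
  sup [set lambda : R | 0 < lambda /\
    exists u v : 'cV[R]_n,
      [/\ simplex u, simplex v, supp u \subset supp x
        & A *m u - A *m v = (lambda / enorm (A *m x)) *: (A *m x)]].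

Definition restricted_width (R : realType) (m n : nat) (A : 'M[R]_(m, n)) : R :=
  inf [set restricted_width_at A x | x in admissible A].

(* Main.v *)
Require Import Defs.
From mathcomp Require Import all_boot all_order all_algebra.
From mathcomp Require Import all_classical all_reals.
From mathcomp Require Import topology normedtype realfun ring lra.
Set Implicit Arguments.
Unset Strict Implicit.
Unset Printing Implicit Defensive.
Import Order.TTheory GRing.Theory Num.Theory.
Import numFieldNormedType.Exports.
Local Open Scope classical_set_scope.
Local Open Scope ring_scope.

(** Both widths are values f (supp x) x of a function f S x in which the index
set S is decoupled from x; f is monotone in S and depends on x only through the
direction of A x. Removing nonnegative relations from x (as in Caratheodory's
theorem) keeps A x, shrinks the support and leads to finitely many index sets S
such that A does not vanish on the face of the simplex spanned by S. On each of
these compact faces f S is lower semicontinuous, so it has a minimizer, whose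
support may be smaller than S, which only decreases the value. Hence the least
of the finitely many minima is the minimum of f (supp x) x over all x.

For the restricted width, lower semicontinuity at x holds because a nearby
point of the face is y = c x + (1 - c) z with c close to 1 and z in the face,
so convex combinations with 0 in conv(A) turn a witness for x into one for y.

If A u - A v = (lambda / |A x|) A x, pairing with A x / |A x| shows that lambda
is the average, with weights u_l v_j, of the ratios in the definition of w(A),
so it is at most their maximum; and lambda = |A x| / |x|_1 is always feasible. *)

(** * Minima of semicontinuous functions and compactness of boxes *)

Lemma lsc_compact_min (R : realType) (T : topologicalType) (K : set T)
    (f : T -> R) (b : R) :
  compact K -> K !=set0 -> (forall x, K x -> b <= f x) ->
  (forall x e, K x -> 0 < e -> \forall y \near x, K y -> f x - e < f y) ->
  exists2 x, K x & forall y, K y -> f x <= f y.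
Proof.
move=> Kc [x0 Kx0] fb flsc; set E := [set f x | x in K].
have Einf : has_inf E by split; [exists (f x0), x0|exists b => _ [x Kx <-]; exact: fb].
(* The sets of near-minimizers generate a proper filter on [K]; compactness gives it a cluster point
   [x], the candidate minimizer. *)
pose F := filter_from [set e : R | 0 < e]
  (fun e => [set y | K y /\ f y < inf E + e]).
have PF : ProperFilter F.
  apply: filter_from_proper.
    apply: filter_from_filter; first by exists 1 => /=.
    move=> i j /= i0 j0; exists (Num.min i j) => /=; first by rewrite lt_min i0.
    move=> y [Ky]; rewrite -ltrBlDl lt_min => /andP[yi yj].
    by split; split=> //; rewrite -ltrBlDl.
  move=> e /= e0; have [_ [y Ky <-] ye] := inf_adherent e0 Einf.
  by exists y.
have FK : F K by exists 1 => //= y [].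
have [x [Kx clx]] := Kc F PF FK.
exists x => // y Ky; apply: (@le_trans _ _ (inf E)); last first.
  by apply: ge_inf; [exact: Einf.2|exists y].
rewrite leNgt; apply/negP => lt_inf.
(* For this [e] the bounds [inf E + e] and [f x - e] coincide, so semicontinuity keeps
   near-minimizers away from [x], against clustering. *)
pose e := (f x - inf E) / 2.
have e0 : 0 < e by rewrite /e; lra.
have [z [[Kz fz] /(_ Kz)]] : [set z | K z /\ f z < inf E + e] `&`
    [set y | K y -> f x - e < f y] !=set0.
  by apply: clx; [exists e|exact: flsc].
by move: fz; rewrite /e; lra.
Qed.

Lemma trmx_continuous (R : realType) (m n : nat) :
  continuous (fun M : 'M[R]_(m, n) => M^T).
Proof.
move=> M P [Q MQ QP]; exists (fun i j => Q j i) => [i j|N NQ].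
  by have := MQ j i; rewrite mxE.
by apply: QP => i j; rewrite mxE.
Qed.

Lemma cV_compact (R : realType) (n : nat) (A : 'I_n -> set R) :
  (forall i, compact (A i)) -> compact [set x : 'cV[R]_n | forall i, A i (x i 0)].
Proof.
move=> /rV_compact Ac.
have -> : [set x : 'cV[R]_n | forall i, A i (x i 0)] =
    trmx @` [set v : 'rV[R]_n | forall i, A i (v ord0 i)].
  apply/seteqP; split=> [x Ax|_ [v Av <-] i]; last by rewrite mxE; exact: Av.
  by exists x^T; rewrite ?trmxK // => i; rewrite mxE.
apply: continuous_compact Ac; apply: continuous_subspaceT.
exact: trmx_continuous.
Qed.

(** * Norms, simplex, supports and continuity *)

Section vectors.
Context {R : realType}.

Lemma dotvE (n : nat) (x y : 'cV[R]_n) : dotv x y = (x^T *m y) 0 0.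
Proof. by rewrite mxE; apply: eq_bigr => i _; rewrite mxE. Qed.

Lemma dotv_ge0 (n : nat) (x : 'cV[R]_n) : 0 <= dotv x x.
Proof. by apply: sumr_ge0 => i _; rewrite -expr2 sqr_ge0. Qed.

Lemma enorm_sqr (n : nat) (x : 'cV[R]_n) : enorm x ^+ 2 = dotv x x.
Proof. by rewrite sqr_sqrtr // dotv_ge0. Qed.

Lemma enorm_gt0 (n : nat) (x : 'cV[R]_n) : x != 0 -> 0 < enorm x.
Proof.
move=> x0; rewrite sqrtr_gt0 lt_neqAle dotv_ge0 andbT eq_sym.
apply: contra x0; rewrite psumr_eq0 => [/allP xx|i _]; last first.
  by rewrite -expr2 sqr_ge0.
apply/eqP/colP => i; rewrite mxE; apply/eqP.
by have := xx i (mem_index_enum i); rewrite /= mulf_eq0 orbb.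
Qed.

Lemma enormZ (n : nat) (c : R) (x : 'cV[R]_n) :
  0 <= c -> enorm (c *: x) = c * enorm x.
Proof.
move=> c0; rewrite /enorm !dotvE -scalemxAr linearZ /= -scalemxAl scalerA mxE.
by rewrite sqrtrM ?mulr_ge0 // -expr2 sqrtr_sqr ger0_norm.
Qed.

Lemma dotv_mulmx (m n : nat) (A : 'M[R]_(m, n)) (x : 'cV[R]_m) (u : 'cV[R]_n) :
  dotv x (A *m u) = \sum_j u j 0 * dotv x (col j A).
Proof.
rewrite dotvE mulmxA mxE; apply: eq_bigr => j _; rewrite mulrC dotvE.
by congr (_ * _); rewrite !mxE; apply: eq_bigr => k _; rewrite !mxE.
Qed.

Lemma nonneg_norm1 (n : nat) (x : 'cV[R]_n) :
  nonneg x -> norm1 x = \sum_i x i 0.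
Proof. by move=> x0; apply: eq_bigr => i _; rewrite ger0_norm. Qed.

Lemma norm1_gt0 (n : nat) (x : 'cV[R]_n) : x != 0 -> 0 < norm1 x.
Proof.
move=> x0; rewrite lt_neqAle eq_sym sumr_ge0 // andbT.
apply: contra x0; rewrite psumr_eq0 // => /allP xx.
apply/eqP/colP => i; rewrite mxE; apply/eqP.
by have := xx i (mem_index_enum i); rewrite /= normr_eq0.
Qed.

Lemma simplexP (n : nat) (x : 'cV[R]_n) :
  simplex x <-> nonneg x /\ \sum_i x i 0 = 1.
Proof.
by split=> -[x0 x1]; split=> //; move: x1; rewrite nonneg_norm1.
Qed.

Lemma simplex_normalize (n : nat) (x : 'cV[R]_n) :
  nonneg x -> x != 0 -> simplex ((norm1 x)^-1 *: x).
Proof.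
move=> x0 xn0; have n0 := norm1_gt0 xn0; apply/simplexP; split=> [i|].
  by rewrite mxE mulr_ge0 // invr_ge0 ltW.
under eq_bigr do rewrite mxE.
by rewrite -mulr_sumr -nonneg_norm1 // mulVf ?gt_eqF.
Qed.

Lemma simplex_conv (n : nat) (a b : R) (x y : 'cV[R]_n) :
  0 <= a -> 0 <= b -> a + b = 1 -> simplex x -> simplex y ->
  simplex (a *: x + b *: y).
Proof.
move=> a0 b0 ab /simplexP[x0 x1] /simplexP[y0 y1]; apply/simplexP; split=> [i|].
  by rewrite !mxE addr_ge0 ?mulr_ge0.
under eq_bigr do rewrite !mxE.
by rewrite big_split /= -!mulr_sumr x1 y1 !mulr1.
Qed.

Lemma nonneg_notin_supp (n : nat) (x : 'cV[R]_n) (S : {set 'I_n}) (i : 'I_n) :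
  nonneg x -> supp x \subset S -> i \notin S -> x i 0 = 0.
Proof.
move=> x0 /fintype.subsetP xS iS; apply/eqP; rewrite eq_le x0 andbT leNgt.
by apply: contra iS => xi; apply: xS; rewrite inE.
Qed.

Lemma suppZ (n : nat) (c : R) (x : 'cV[R]_n) : 0 < c -> supp (c *: x) = supp x.
Proof. by move=> c0; apply/setP => i; rewrite !inE mxE pmulr_rgt0. Qed.

Lemma supp_conv (n : nat) (a b : R) (x y : 'cV[R]_n) (S : {set 'I_n}) :
  0 <= a -> 0 <= b -> nonneg x -> nonneg y ->
  supp x \subset S -> supp y \subset S -> supp (a *: x + b *: y) \subset S.
Proof.
move=> a0 b0 x0 y0 xS yS; apply/fintype.subsetP => i; apply: contraLR => iS.
rewrite inE !mxE (nonneg_notin_supp x0 xS iS) (nonneg_notin_supp y0 yS iS).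
by rewrite !mulr0 addr0 ltxx.
Qed.

Lemma mulmx_neq0 (m n : nat) (A : 'M[R]_(m, n)) (x : 'cV[R]_n) :
  A *m x != 0 -> x != 0.
Proof. by apply: contraNneq => ->; rewrite mulmx0. Qed.

Lemma mulmx_coord_continuous (m n : nat) (A : 'M[R]_(m, n)) (i : 'I_m) :
  continuous (fun x : 'cV[R]_n => (A *m x) i 0).
Proof.
under eq_fun do rewrite mxE.
apply: continuous_big => [|j _ x]; first exact: add_continuous.
by apply: continuousM; [exact: cst_continuous|exact: coord_continuous].
Qed.

Lemma dotv_mulmx_continuous (m n : nat) (A : 'M[R]_(m, n)) (w : 'cV[R]_m) :
  continuous (fun x : 'cV[R]_n => dotv (A *m x) w).
Proof.
apply: continuous_big => [|i _ x]; first exact: add_continuous.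
by apply: continuousM; [exact: mulmx_coord_continuous|exact: cst_continuous].
Qed.

Lemma enorm_mulmx_continuous (m n : nat) (A : 'M[R]_(m, n)) :
  continuous (fun x : 'cV[R]_n => enorm (A *m x)).
Proof.
move=> x; apply: (@continuous_comp _ _ _ (fun x => dotv (A *m x) (A *m x))).
  apply: continuous_big => [|i _ y]; first exact: add_continuous.
  by apply: continuousM; exact: mulmx_coord_continuous.
exact: sqrt_continuous.
Qed.

End vectors.

(** * Reduction of the cone to finitely many compact faces *)

Section minimum_over_cone.
Context {R : realType} {m n : nat}.
Variable A : 'M[R]_(m, n).
Implicit Types (x y z : 'cV[R]_n) (S : {set 'I_n}).

(** Asking only that the support be included in [S] keeps the boundary, so that the face is
    closed. *)
Definition face S : set 'cV[R]_n := [set x | simplex x /\ supp x \subset S].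

(* Only nonnegative relations among the columns are excluded; linear
   independence would be more than what is needed for A x != 0 on the face. *)
Definition acyclic S :=
  forall z, nonneg z -> supp z \subset S -> A *m z = 0 -> z = 0.

(** The face is a product of compact sets, [[0, 1]] on [S] and the point 0 off [S], cut by a closed
    hyperplane. *)
Lemma face_compact S : compact (face S).
Proof.
have -> : face S =
    [set x | forall i, (if i \in S then `[0, 1]%classic else [set 0]) (x i 0)] `&`
    [set x | \sum_i x i 0 = 1].
  apply/seteqP; split=> [x [/simplexP[x0 x1] xS]|x [xS x1]].
    split=> // i; case: ifPn => [_|/nonneg_notin_supp]; last exact.
    rewrite /= in_itv /= x0 -x1 (bigD1 i) //= lerDl.
    exact: sumr_ge0.
  split.
    apply/simplexP; split=> // i; move: (xS i).
    by case: ifP => _ /=; [rewrite in_itv => /andP[]|move=> ->].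
  apply/fintype.subsetP => i; rewrite inE; apply: contraLR => iS.
  by move: (xS i); rewrite (negbTE iS) /= => ->; rewrite ltxx.
apply: compact_closedI.
  apply: (@cV_compact _ _ (fun i => if i \in S then `[0, 1]%classic else [set 0])).
  by move=> i; case: ifP => _; [exact: segment_compact|exact: compact_set1].
apply: (@preimage_closed _ _ (fun x : 'cV[R]_n => \sum_i x i 0) [set 1]).
  move=> x _; apply: continuous_big; first exact: add_continuous.
  by move=> i _; exact: coord_continuous.
exact: closed_eq.
Qed.

(** Induction on the size of the support: subtracting a multiple of a nonzero nonnegative relation
    [z] on [supp x] leaves [A *m x] unchanged, and as [z] is nonnegative no new index enters the
    support. *)
Lemma acyclic_reduction x : nonneg x ->
  exists y, [/\ nonneg y, A *m y = A *m x, supp y \subset supp x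
    & acyclic (supp y)].
Proof.
have [k] := ubnP #|supp x|; elim: k x => // k IH x; rewrite ltnS => xk x0.
have [acx|] := pselect (acyclic (supp x)); first by exists x.
move=> /existsNP[z /not_implyP[z0 /not_implyP[zx /not_implyP[Az zn0]]]].
have [i0 zi0] : exists i, i \in supp z.
  apply/set0Pn; apply/eqP => sz; apply: zn0; apply/colP => i.
  by rewrite mxE; apply: (nonneg_notin_supp z0 (subxx _)); rewrite sz inE.
case: (arg_minP (fun i => x i 0 / z i 0) zi0) => i1 zi1 tmin.
(* The largest step along -z that stays nonnegative; it annihilates i1. *)
pose t := x i1 0 / z i1 0; pose y := x - t *: z.
have t0 : 0 <= t by rewrite divr_ge0.
have y0 : nonneg y.
  move=> i; rewrite !mxE subr_ge0.
  have [zi|zi] := boolP (i \in supp z).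
    have := tmin i zi; rewrite ler_pdivlMr //; by move: zi; rewrite inE.
  by rewrite (nonneg_notin_supp z0 (subxx _) zi) mulr0.
have yx : supp y \subset supp x.
  apply/fintype.subsetP => i; rewrite !inE !mxE => /lt_le_trans; apply.
  by rewrite gerBl mulr_ge0.
have ltyx : (#|supp y| < #|supp x|)%N.
  apply: proper_card; apply/properP; split=> //; exists i1.
    exact: (fintype.subsetP zx).
  rewrite inE !mxE /t divfK ?subrr ?ltxx //.
  by have : i1 \in supp z := zi1; rewrite inE => /gt_eqF ->.
have [w [w0 Aw wy acw]] := IH y (leq_trans ltyx xk) y0.
exists w; split=> //; last exact: fintype.subset_trans yx.
by rewrite Aw mulmxBr -scalemxAr Az scaler0 subr0.
Qed.

Lemma min_over_cone (f : {set 'I_n} -> 'cV[R]_n -> R) :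
  A != 0 ->
  (forall S x, nonneg x -> A *m x != 0 -> supp x \subset S -> 0 <= f S x) ->
  (forall (S T : {set 'I_n}) x, nonneg x -> A *m x != 0 -> supp x \subset S -> S \subset T ->
     f S x <= f T x) ->
  (forall S (c : R) x y, 0 < c -> A *m x != 0 -> A *m y = c *: (A *m x) ->
     f S y = f S x) ->
  (forall S x (e : R), face S x -> A *m x != 0 -> 0 < e ->
     \forall y \near x, face S y -> f S x - e < f S y) ->
  exists2 x, admissible A x & forall y, admissible A y ->
    f (supp x) x <= f (supp y) y.
Proof.
move=> A0 f_ge0 f_mono f_dir f_lsc.
(* Nonempty, so that the face has a point; acyclic, so that [A] does not vanish on it. *)
pose good S := `[< S != finset.set0 /\ acyclic S >].
have face_n0 S x : acyclic S -> face S x -> A *m x != 0.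
  move=> acS [/simplexP[x0 x1] xS]; apply/eqP => Ax.
  have /eqP := x1; rewrite (acS x x0 xS Ax) big1 ?(eq_sym 0) ?oner_eq0 //.
  by move=> i _; rewrite mxE.
(* [good S] sits under the existential so that [choice] yields a function [g] on all index sets,
   with arbitrary values at those that are not good. *)
have min_face S : exists x, good S -> face S x /\
    forall y, face S y -> f S x <= f S y.
  have [/asboolP[/set0Pn[i iS] acS]|] := boolP (good S); last by exists 0.
  have [|x Kx|x e Kx|x Kx xmin] :=
      @lsc_compact_min R _ (face S) (f S) 0 (@face_compact S).
  - exists (delta_mx i 0); split.
      apply/simplexP; split=> [j|]; first by rewrite mxE ler0n.
      rewrite (bigD1 i) //= big1 ?mxE ?eqxx ?addr0 // => j /negbTE ji.
      by rewrite mxE ji.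
    apply/fintype.subsetP => j; rewrite inE mxE eqxx andbT.
    by case: eqP => [->//|_]; rewrite ltxx.
  - by apply: f_ge0; [case: Kx => -[]|exact: face_n0 Kx|case: Kx].
  - by apply: f_lsc => //; exact: face_n0 Kx.
  - by exists x.
have [g gP] := choice min_face.
have red y : admissible A y -> exists S, good S /\ f S (g S) <= f (supp y) y.
  move=> [y0 Ay]; have [z [z0 Az zy acz]] := acyclic_reduction y0.
  have Az0 : A *m z != 0 by rewrite Az.
  have zn0 := mulmx_neq0 Az0.
  have gz : good (supp z).
    apply/asboolP; split=> //; apply: contra zn0 => /eqP sz.
    apply/eqP/colP => i; rewrite mxE.
    by apply: (nonneg_notin_supp z0 (subxx _)); rewrite sz inE.
  (* For the normalization [p] of [z], the chain is f (supp z) (g (supp z)) <= f (supp z) p = f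
     (supp z) z <= f (supp y) z = f (supp y) y; the equalities hold since the direction of the image
     under [A] is the same. *)
  exists (supp z); split=> //; have [_ gmin] := gP _ gz.
  have cz : 0 < (norm1 z)^-1 by rewrite invr_gt0 norm1_gt0.
  apply: le_trans (f_mono _ _ _ y0 Ay (subxx _) (subxx _)).
  apply: (@le_trans _ _ (f (supp z) ((norm1 z)^-1 *: z))).
    by apply: gmin; split; [exact: simplex_normalize|rewrite suppZ].
  rewrite (f_dir _ _ z _ cz Az0) ?scalemxAr //.
  apply: (@le_trans _ _ (f (supp y) z)); first exact: f_mono.
  by rewrite (f_dir _ 1 y z) ?scale1r.
have [y adm_y] : exists y, admissible A y.
  have [j /eqP Aj] : exists j, col j A <> 0.
    apply/existsNP => A0'; move/eqP: A0; apply; apply/matrixP => i j.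
    by have /colP/(_ i) := A0' j; rewrite !mxE.
  exists (delta_mx j 0); split; last by rewrite -colE.
  by move=> i; rewrite mxE ler0n.
have [S0 [gS0 _]] := red y adm_y.
case: (arg_minP (fun S => f S (g S)) gS0) => S gS Smin.
have [[gx gsupp] _] := gP S gS; have acS : acyclic S by case/asboolP: gS.
have Ag : A *m g S != 0 by apply: (face_n0 S) => //; split.
have g0 : nonneg (g S) by case: gx.
exists (g S); first by split.
(* The support of [g S] may be smaller than [S]; by monotonicity its value is still at most
   [f S (g S)], the least of the minima. *)
move=> z /red[T [gT fT]]; apply: le_trans fT.
by apply: le_trans (Smin T gT); exact: f_mono.
Qed.

End minimum_over_cone.

(** * The two widths with a free index set *)

Section widths.
Context {R : realType} {m n : nat}.
Variable A : 'M[R]_(m, n).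
Implicit Types (x y z u v : 'cV[R]_n) (S T : {set 'I_n}).

(** At [S = supp x] this unfolds to [width_at A x], and the supremum of [restricted_set S x] below
    to [restricted_width_at A x]. *)
Definition width_on S x : R :=
  \big[Num.max/0]_(l in S) \big[Num.max/0]_(j < n)
    (dotv (A *m x) (col l A - col j A) / enorm (A *m x)).

Definition restricted_set S x : set R :=
  [set lambda : R | 0 < lambda /\
    exists u v : 'cV[R]_n,
      [/\ simplex u, simplex v, supp u \subset S
        & A *m u - A *m v = (lambda / enorm (A *m x)) *: (A *m x)]].

Lemma width_on_ge0 S x : 0 <= width_on S x.
Proof. exact: bigmax_ge_id. Qed.

Lemma width_on_subset S T x : S \subset T -> width_on S x <= width_on T x.
Proof. by move=> /fintype.subsetP ST; apply: sub_bigmax. Qed.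

Lemma width_on_dir S (c : R) x y :
  0 < c -> A *m y = c *: (A *m x) -> width_on S y = width_on S x.
Proof.
move=> c0 Ay; rewrite /width_on Ay; apply: eq_bigr => l _; apply: eq_bigr => j _.
rewrite enormZ ?ltW // !dotvE linearZ /= -scalemxAl mxE.
by rewrite invfM mulrACA divff ?gt_eqF // mul1r.
Qed.

Lemma width_on_continuous S x :
  A *m x != 0 -> {for x, continuous (width_on S)}.
Proof.
move=> Ax.
have max_cont : continuous (fun p : R * R => Num.max p.1 p.2).
  by move=> p; apply: continuous_max; [exact: cvg_fst|exact: cvg_snd].
apply: (@cvg_big _ _ _ _ _ max_cont _ (nbhs x)) => l _.
apply: (@cvg_big _ _ _ _ _ max_cont _ (nbhs x)) => j _.
apply: (@continuousM R _ (fun y => dotv (A *m y) (col l A - col j A))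
  (fun y => (enorm (A *m y))^-1)); first exact: dotv_mulmx_continuous.
apply: continuousV; first by rewrite gt_eqF // enorm_gt0.
exact: enorm_mulmx_continuous.
Qed.

Lemma restricted_le_width S x (lambda : R) :
  A *m x != 0 -> restricted_set S x lambda -> lambda <= width_on S x.
Proof.
move=> /enorm_gt0 Ax [_ [u [v [/simplexP[u0 u1] /simplexP[v0 v1] uS Auv]]]].
(* The component of column [j] along the unit vector in the direction of [A *m x]. *)
pose c j := dotv (A *m x) (col j A) / enorm (A *m x).
have cB l j : dotv (A *m x) (col l A - col j A) / enorm (A *m x) = c l - c j.
  by rewrite /c !dotvE mulmxBr !mxE mulrBl.
have -> : lambda = \sum_l \sum_j u l 0 * v j 0 * (c l - c j).
  transitivity (dotv (A *m x) (A *m u - A *m v) / enorm (A *m x)).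
    rewrite Auv dotvE -scalemxAr mxE -dotvE -enorm_sqr expr2.
    by field; rewrite gt_eqF.
  transitivity (\sum_l u l 0 * c l - \sum_j v j 0 * c j).
    rewrite dotvE mulmxBr !mxE mulrBl; congr (_ - _).
      have := dotv_mulmx A (A *m x) u; rewrite dotvE mxE => ->.
      by rewrite mulr_suml; apply: eq_bigr => l _; rewrite mulrA.
    have := dotv_mulmx A (A *m x) v; rewrite dotvE mxE => ->.
    by rewrite mulr_suml; apply: eq_bigr => l _; rewrite mulrA.
  transitivity (\sum_l u l 0 * (c l - \sum_j v j 0 * c j)).
    under [RHS]eq_bigr do rewrite mulrBr.
    by rewrite sumrB -mulr_suml u1 mul1r.
  apply: eq_bigr => l _; rewrite -[in LHS](mul1r (c l)) -v1 mulr_suml -sumrB.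
  by rewrite mulr_sumr; apply: eq_bigr => j _; rewrite -mulrBr mulrA.
apply: (@le_trans _ _ (\sum_l \sum_j u l 0 * v j 0 * width_on S x)).
  apply: ler_sum => l _; apply: ler_sum => j _.
  (* An index [l] outside [S] has weight zero, so only ratios that enter the maximum [width_on S x]
     remain. *)
  have [lS|/(nonneg_notin_supp u0 uS) ->] := boolP (l \in S); last first.
    by rewrite !mul0r.
  apply: ler_wpM2l; first exact: mulr_ge0.
  rewrite -cB; apply: le_trans (le_bigmax_cond _ _ lS).
  exact: (le_bigmax _ _ j).
under eq_bigr do under eq_bigr do rewrite mulrAC.
under eq_bigr do rewrite -mulr_sumr v1 mulr1.
by rewrite -mulr_suml u1 mul1r.
Qed.

(** * Feasibility and semicontinuity of the restricted width *)

Hypothesis conv0 : conv_cols A 0.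

(** Take for [u] the normalized [x] and for [v] weights of a convex combination equal to 0. *)
Lemma restricted_set_mem S x : nonneg x -> A *m x != 0 -> supp x \subset S ->
  restricted_set S x (enorm (A *m x) / norm1 x).
Proof.
move=> x0 Ax xS; have xn0 := mulmx_neq0 Ax; have nx := norm1_gt0 xn0.
have ex := enorm_gt0 Ax; case: conv0 => v sv Av.
split; first exact: divr_gt0.
exists ((norm1 x)^-1 *: x), v; split=> //; first exact: simplex_normalize.
  by rewrite suppZ // invr_gt0.
rewrite Av subr0 -scalemxAr; congr (_ *: _).
by rewrite mulrAC divff ?mul1r // gt_eqF.
Qed.

(** The bound by [width_on S x] makes [sup] a true least upper bound rather than its default
    value. *)
Lemma restricted_set_has_sup S x : nonneg x -> A *m x != 0 ->
  supp x \subset S -> has_sup (restricted_set S x).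
Proof.
move=> x0 Ax xS; split.
  by exists (enorm (A *m x) / norm1 x); exact: restricted_set_mem.
by exists (width_on S x) => lambda; exact: restricted_le_width.
Qed.

Lemma restricted_sup_gt0 S x : nonneg x -> A *m x != 0 ->
  supp x \subset S -> 0 < sup (restricted_set S x).
Proof.
move=> x0 Ax xS; have [lambda0 _] := restricted_set_mem x0 Ax xS.
apply: lt_le_trans lambda0 _; apply: sup_upper_bound.
  exact: restricted_set_has_sup.
exact: restricted_set_mem.
Qed.

Lemma restricted_sup_subset S T x : nonneg x -> A *m x != 0 ->
  supp x \subset S -> S \subset T ->
  sup (restricted_set S x) <= sup (restricted_set T x).
Proof.
move=> x0 Ax xS ST; have [ne _] := restricted_set_has_sup x0 Ax xS.
apply: ge_sup => // lambda [l0 [u [v [su sv uS uv]]]].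
apply: sup_upper_bound.
  by apply: restricted_set_has_sup => //; exact: fintype.subset_trans ST.
by split=> //; exists u, v; split=> //; exact: fintype.subset_trans ST.
Qed.

Lemma restricted_set_dir S (c : R) x y : 0 < c -> A *m y = c *: (A *m x) ->
  restricted_set S y = restricted_set S x.
Proof.
move=> c0 Ay; apply/seteqP.
have E (lambda : R) : (lambda / enorm (A *m y)) *: (A *m y) =
    (lambda / enorm (A *m x)) *: (A *m x).
  rewrite Ay enormZ ?ltW // scalerA; congr (_ *: _).
  by rewrite invfM -mulrA [X in _ * X]mulrC mulVKf // gt_eqF.
by split=> lambda [l0 [u [v [su sv uS uv]]]]; split=> //; exists u, v;
  split=> //; rewrite uv E.
Qed.

Lemma restricted_set_nearby S x y (lambda c : R) :
  face S x -> A *m x != 0 -> face S y -> A *m y != 0 ->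
  restricted_set S x lambda -> 0 < c < 1 -> (forall i, c * x i 0 <= y i 0) ->
  restricted_set S y
    (enorm (A *m y) / (c * (enorm (A *m x) / lambda) + (1 - c))).
Proof.
move=> [sx xS] Ax [sy yS] Ay [l0 [u [v [su sv uS uv]]]] /andP[c0 c1] cxy.
have ex := enorm_gt0 Ax; have ey := enorm_gt0 Ay.
case: conv0 => w sw Aw.
(* y = c x + (1 - c) z, hence with a = c |Ax| / lambda and k = a + (1 - c),
   A y = a (A u - A v) + (1 - c) (A z - A w) is k times a difference of convex
   combinations. *)
pose a := c * (enorm (A *m x) / lambda); pose k := a + (1 - c).
have a0 : 0 < a by rewrite !mulr_gt0 ?invr_gt0.
have d0 : 0 < 1 - c by rewrite subr_gt0.
have k0 : 0 < k by exact: addr_gt0.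
pose z := (1 - c)^-1 *: (y - c *: x).
have [/simplexP[x0 x1] /simplexP[y0 y1]] := (sx, sy).
have sz : simplex z.
  apply/simplexP; split=> [i|].
    by rewrite !mxE mulr_ge0 ?invr_ge0 ?(ltW d0) // subr_ge0.
  under eq_bigr do rewrite !mxE.
  by rewrite -mulr_sumr sumrB -mulr_sumr x1 y1 mulr1 mulVf // gt_eqF.
have zS : supp z \subset S.
  apply/fintype.subsetP => i; apply: contraLR => iS.
  rewrite inE !mxE (nonneg_notin_supp x0 xS iS) (nonneg_notin_supp y0 yS iS).
  by rewrite mulr0 subr0 mulr0 ltxx.
have ak : a / k + (1 - c) / k = 1 by rewrite -mulrDl divff // gt_eqF.
have ak0 : 0 <= a / k by rewrite divr_ge0 ?ltW.
have dk0 : 0 <= (1 - c) / k by rewrite divr_ge0 ?ltW.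
split; first by rewrite divr_gt0.
exists ((a / k) *: u + ((1 - c) / k) *: z).
exists ((a / k) *: v + ((1 - c) / k) *: w); split.
- exact: simplex_conv.
- exact: simplex_conv.
- by apply: supp_conv => //; [case: su|case: sz].
rewrite !mulmxDr -!scalemxAr Aw scaler0 addr0 addrAC -scalerBr uv.
rewrite mulmxBr -scalemxAr -/a -/k; clearbody k; rewrite /a.
move: (A *m x) (A *m y) ex ey => X Y ex ey {a a0 ak ak0 uv Ax Ay}.
apply/matrixP => i j; rewrite !mxE.
by field; rewrite !gt_eqF.
Qed.

(** The value given by [restricted_set_nearby] tends to [lambda] as [c] tends to 1 and [y] to [x].
    So [lambda] is taken close to the supremum, then [c] is fixed close to 1, and last [y] is moved
    close to [x]. *)
Lemma restricted_sup_lsc S x (e : R) : face S x -> A *m x != 0 -> 0 < e ->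
  \forall y \near x, face S y ->
    sup (restricted_set S x) - e < sup (restricted_set S y).
Proof.
move=> fx Ax e0; have [sx xS] := fx; have x0 : nonneg x by case: sx.
have ex := enorm_gt0 Ax.
have hs := restricted_set_has_sup x0 Ax xS.
have [lambda Ll lte] := sup_adherent e0 hs; have l0 : 0 < lambda := Ll.1.
set b := sup _ - e in lte *.
pose k c := c * (enorm (A *m x) / lambda) + (1 - c).
have k_cont : continuous k.
  move=> c; apply: (@cvgD _ R^o); first by apply: cvgMr_tmp; exact: cvg_id.
  by apply: (@cvgB _ R^o); [exact: cvg_cst|exact: cvg_id].
have k1 : k 1 = enorm (A *m x) / lambda by rewrite /k mul1r subrr addr0.
have [c [/andP[c0 c1] bc]] : exists c : R, 0 < c < 1 /\ b < enorm (A *m x) / k c.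
  have : \forall c \near (1 : R)^'-, 0 < c < 1 /\ b < enorm (A *m x) / k c.
    near=> c; split; first by apply/andP; split; near: c;
      [exact: nbhs_left_gt|exact: nbhs_left_lt].
    near: c; apply: (@cvgr_gt _ _ _ _ _ (enorm (A *m x) / k 1)).
      apply: cvg_at_left_filter; apply: cvgMl_tmp; apply: cvgV; last exact: k_cont.
      by rewrite k1 gt_eqF // divr_gt0.
    by rewrite k1 invfM invrK mulrA mulfV ?gt_eqF ?mul1r.
  by move/filter_ex.
have near_b : \forall y \near x, b < enorm (A *m y) / k c.
  apply: (@cvgr_gt _ _ (nbhs x) _ (fun y => enorm (A *m y) / k c)) bc.
  by apply: cvgMr_tmp; exact: enorm_mulmx_continuous.
have near_n0 : \forall y \near x, 0 < enorm (A *m y).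
  apply: (@cvgr_gt _ _ (nbhs x) _ (fun y => enorm (A *m y))) ex.
  exact: enorm_mulmx_continuous.
(* The strict inequality is an open condition on [y] where [x i 0] is positive; where it is zero,
   the weak one needed below is just nonnegativity of [y]. *)
have near_c : \forall y \near x, forall i : 'I_n, 0 < x i 0 -> c * x i 0 < (y : 'cV[R]_n) i 0.
  apply: (@filter_forall _ _ (fun (i : 'I_n) (y : 'cV[R]_n) =>
    0 < x i 0 -> c * x i 0 < y i 0) (nbhs x)) => i.
  have [xi|_] := boolP (0 < x i 0); last exact: nearW.
  have : \forall y \near x, c * x i 0 < (y : 'cV[R]_n) i 0.
    apply: (@cvgr_gt _ _ (nbhs x) _ (fun y => y i 0) (x i 0)).
      exact: coord_continuous.
    by rewrite gtr_pMl.
  by apply: filterS.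
near=> y => fy.
have [sy yS] := fy; have y0 : nonneg y by case: sy.
have Ay : A *m y != 0.
  have : 0 < enorm (A *m y) by near: y.
  by apply: contraTneq => ->; rewrite /enorm dotvE mulmx0 mxE sqrtr0 ltxx.
have yc i : c * x i 0 <= y i 0.
  have := x0 i; rewrite le_eqVlt => /predU1P[<-|xi]; first by rewrite mulr0.
  by apply: ltW; move: i xi; near: y.
apply: (@lt_le_trans _ _ (enorm (A *m y) / k c)); first by near: y.
apply: sup_upper_bound; first exact: restricted_set_has_sup.
by apply: (restricted_set_nearby fx); rewrite ?c0.
Unshelve. all: by end_near.
Qed.

End widths.

(** * Attained infima and the comparison of the widths *)

Lemma is_min_inf (R : realType) (E : set R) (r : R) : is_min E r -> inf E = r.
Proof.
move=> [Er lbr]; apply/eqP; rewrite eq_le; apply/andP; split.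
  by apply: ge_inf => //; exists r.
by apply: lb_le_inf => //; exists r.
Qed.

Theorem corollary1 (R : realType) (m n : nat) (A : 'M[R]_(m, n))
    (A_neq0 : A != 0) (conv0 : conv_cols A 0) :
  [/\ is_min [set width_at A x | x in admissible A] (relative_width A),
      is_min [set restricted_width_at A x | x in admissible A]
        (restricted_width A),
      restricted_width A <= relative_width A
    & 0 < restricted_width A].
Proof.
have [xw adm_w wmin] : exists2 x, admissible A x & forall y, admissible A y ->
    width_on A (supp x) x <= width_on A (supp y) y.
  apply: min_over_cone => // [S x *|S T x _ _ _|S c x y c0 _|S x e _ Ax e0].
  - exact: width_on_ge0.
  - exact: width_on_subset.
  - exact: width_on_dir.
  - have : \forall y \near x, width_on A S x - e < width_on A S y.
      apply: (@cvgr_gt _ _ (nbhs x) _ (width_on A S) (width_on A S x)).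
        exact: width_on_continuous.
      by rewrite gtrBl.
    by apply: filterS => y ? _.
have [xr adm_r rmin] : exists2 x, admissible A x & forall y, admissible A y ->
    sup (restricted_set A (supp x) x) <= sup (restricted_set A (supp y) y).
  apply: (@min_over_cone _ _ _ _ (fun S x => sup (restricted_set A S x))) => //.
  - by move=> S x x0 Ax xS; exact/ltW/restricted_sup_gt0.
  - by move=> S T x x0 Ax xS ST; exact: restricted_sup_subset.
  - by move=> S c x y c0 _ /(restricted_set_dir S c0) ->.
  - by move=> S x e fx Ax e0; exact: restricted_sup_lsc.
have min_w : is_min [set width_at A x | x in admissible A] (width_at A xw).
  by split; [exists xw|move=> _ [y adm_y <-]; exact: wmin].
have min_r : is_min [set restricted_width_at A x | x in admissible A]
    (restricted_width_at A xr).
  by split; [exists xr|move=> _ [y adm_y <-]; exact: rmin].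
have [w0 Aw] := adm_w; have [r0 Ar] := adm_r.
rewrite /relative_width (is_min_inf min_w) /restricted_width (is_min_inf min_r).
split=> //; last exact: restricted_sup_gt0.
(* Both widths are compared at [xw], where the relative width is attained. *)
apply: (@le_trans _ _ (restricted_width_at A xw)); first exact: rmin.
apply: ge_sup => [|lambda]; last exact: restricted_le_width.
by exists (enorm (A *m xw) / norm1 xw); exact: restricted_set_mem.
Qed.
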